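(* Let $\mathcal{C}$ be a quasicategory equipped with a distinguished class of morphisms called cofibrations which contains all identity morphisms of $\mathcal{C}$. Suppose $\mathcal{C}$ admits pushouts along cofibrations, we select a functorial choice of pushouts along cofibrations in $\mathcal{C}$, and we use this to compute object-wise all pushouts along object-wise cofibrations in all quasicategories of diagrams in $\mathcal{C}$. Let $T,U,V$ be diagrams in $\mathcal{C}$ of the shape $\Delta[2]\times\Delta[n]\times\Delta[n]$. If $V\leftarrow T\to U$ is a diagram in $\mathcal{C}^{\Delta[2]\times\Delta[n]\times\Delta[n]}$ and the map $T\to V$ is an object-wise cofibration, then the pushout object $P$, as a diagram in $\mathcal{C}$ of shape $\Delta[2]\times\Delta[n]\times\Delta[n]$, is compatible with all face and degeneracy maps. In other words, $d_iP$ is the pushout of $d_iT,d_iU,d_iV$, while $s_iP$ is the pushout of $s_iT,s_iU,s_iV$. The face and degeneracy maps here are $$d_iP:=P\circ\bigl(\mathrm{Id}_{\Delta[2]}\times(\delta^i)^*\times(\delta^i)^*\bigr),\qquad s_iP:=P\circ\bigl(\mathrm{Id}_{\Delta[2]}\times(\sigma^i)^*\times(\sigma^i)^*\bigr).$$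
   Context: Identity morphisms are the degenerate 1-simplices. A simplicial subset is 0-full if a simplex belongs to it exactly when all its vertices do. $\mathcal{J}=\Delta[1]\times\Delta[1]$, and $\mathcal{I}\subseteq\mathcal{J}$ is the nerve of the subcategory of the commutative square determined by the top horizontal map and the left vertical map. $\mathcal{C}^{\mathcal{I}}_{co}$ is the 0-full sub quasicategory of $\mathcal{C}^{\mathcal{I}}$ on the diagrams $C_3\leftarrowtail C_1\to C_2$ with left vertical map $C_1\to C_3$ a cofibration; $\mathcal{C}^{\mathcal{J}}_{co,po}$ is the 0-full sub quasicategory of $\mathcal{C}^{\mathcal{J}}$ on the pushout squares with left vertical map a cofibration. A functorial choice of pushouts along cofibrations is a map $F_{po}\colon\mathcal{C}^{\mathcal{I}}_{co}\to\mathcal{C}^{\mathcal{J}}_{co,po}$ that is a strict right inverse to restriction along $\mathcal{I}\hookrightarrow\mathcal{J}$. For a simplicial set $K$, a morphism $K\times\Delta[1]\to\mathcal{C}$ of $\mathcal{C}^K$ is an object-wise cofibration if its component at each vertex of $K$ is a cofibration; computing pushouts along object-wise cofibrations in $\mathcal{C}^K$ object-wise means applying $(F_{po})^K\colon(\mathcal{C}^{\mathcal{I}}_{co})^K\to(\mathcal{C}^{\mathcal{J}}_{co,po})^K$, $y\mapsto F_{po}\circ y$, under the identification $(\mathcal{C}^{\mathcal{I}}_{co})^K\cong(\mathcal{C}^K)^{\mathcal{I}}_{co}$, and ''the pushout'' means this selected one. $\delta^i\colon[n-1]\to[n]$ is the increasing map skipping $i$, $\sigma^i\colon[n+1]\to[n]$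 the weakly increasing surjection hitting $i$ twice, and $(\delta^i)^*$, $(\sigma^i)^*$ denote the induced maps $\Delta[n-1]\to\Delta[n]$, $\Delta[n+1]\to\Delta[n]$; $d_i,s_i$ are defined on $T,U,V$ and the maps between them by the same precompositions. *)

(* Defs.v *)
From HB Require Import structures.
From mathcomp Require Import all_boot all_order.
From mathcomp Require Import boolp.

Set Implicit Arguments.
Unset Strict Implicit.
Unset Printing Implicit Defensive.

Import Order.TTheory.

#[local] Obligation Tactic := try done; simpl.

Notation dhom m n := {omorphism 'I_m.+1 -> 'I_n.+1}.

Lemma dhom_eq m n (a b : dhom m n) : a =1 b -> a = b.
Proof.
case: a b => [a [[pa]]] [b [[pb]]] /= /funext e; rewrite e in pa *.
by rewrite (Prop_irrelevance pa pb).
Qed.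

Definition mk_dhom m n (f : 'I_m.+1 -> 'I_n.+1)
  (fP : forall i j : 'I_m.+1, (i <= j)%N -> (f i <= f j)%N) : dhom m n :=
  HB.pack f (Order.isOrderMorphism.Build _ _ _ _ f fP).

Lemma dhom_leq m n (a : dhom m n) (i j : 'I_m.+1) : (i <= j)%N -> (a i <= a j)%N.
Proof. exact: (@omorph_le _ _ _ _ a i j). Qed.

Definition dconst m n (i : 'I_n.+1) : dhom m n :=
  @mk_dhom m n (fun=> i) (fun _ _ _ => leqnn i).

Fact coface_subproof n (hn : 0 < n) (i : 'I_n.+1) (j k : 'I_n.-1.+1) : j <= k ->
  lift i (cast_ord (prednK hn) j) <= lift i (cast_ord (prednK hn) k).
Proof. by move=> jk; rewrite /= leq_bump2. Qed.

Definition coface n (hn : 0 < n) (i : 'I_n.+1) : dhom n.-1 n :=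
  mk_dhom (@coface_subproof n hn i).

Fact codegen_bound n (i : 'I_n.+1) (j : 'I_n.+2) : unbump i j < n.+1.
Proof.
rewrite /unbump; case: (ltnP i j) => ij; first by rewrite subn1; case: j ij => -[].
by rewrite subn0 (leq_ltn_trans ij).
Qed.

Fact codegen_subproof n (i : 'I_n.+1) (j k : 'I_n.+2) : j <= k ->
  Ordinal (codegen_bound i j) <= Ordinal (codegen_bound i k).
Proof.
move=> jk /=; rewrite /unbump.
case: (ltnP i j) => ij; first by rewrite (leq_trans ij jk) leq_sub2r.
case: (ltnP i k) => ik; last by rewrite !subn0.
by rewrite subn0 (leq_trans ij) // subn1; case: (nat_of_ord k) ik.
Qed.

(* sigma^i : [n+1] -> [n], sending j to j if j <= i and to j - 1 otherwise *)
Definition codegen n (i : 'I_n.+1) : dhom n.+1 n :=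
  mk_dhom (@codegen_subproof n i).

Record sset := SSet {
  simplex :> nat -> Type;
  sact : forall m n, dhom m n -> simplex n -> simplex m;
  sact_id : forall n (x : simplex n), sact (idfun : dhom n n) x = x;
  sact_comp : forall l m n (a : dhom l m) (b : dhom m n) (x : simplex n),
    sact (b \o a : dhom l n) x = sact a (sact b x) }.

Arguments sact {s m n} a x.

Record smap (X Y : sset) := SMap {
  sfun :> forall n, X n -> Y n;
  sfun_act : forall m n (a : dhom m n) (x : X n),
    sfun (sact a x) = sact a (sfun x) }.

Lemma smap_eq X Y (f g : smap X Y) : (forall n (x : X n), f n x = g n x) -> f = g.
Proof.
case: f g => [f pf] [g pg] /= fg.
have e : f = g by apply: functional_extensionality_dep => n; apply: funext.
by rewrite e in pf *; rewrite (Prop_irrelevance pf pg).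
Qed.

Program Definition sid X : smap X X := @SMap X X (fun _ x => x) _.

Program Definition scomp X Y Z (g : smap Y Z) (f : smap X Y) : smap X Z :=
  @SMap X Z (fun n x => g n (f n x)) _.
Next Obligation. by move=> X Y Z g f m n a x; rewrite !sfun_act. Qed.

Definition vtx (X : sset) n (i : 'I_n.+1) (x : X n) : X 0 := sact (dconst 0 i) x.

(* the identity morphism of a vertex: its degenerate 1-simplex *)
Definition idedge (X : sset) (x : X 0) : X 1 := sact (dconst 1 ord0) x.

Lemma vtx_act (X : sset) m n (a : dhom m n) (x : X n) (i : 'I_m.+1) :
  vtx i (sact a x) = vtx (a i) x.
Proof. by rewrite /vtx -sact_comp; congr (sact _ x); apply: dhom_eq. Qed.

Lemma vtx_map (X Y : sset) (f : smap X Y) n (x : X n) (i : 'I_n.+1) :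
  vtx i (f n x) = f 0 (vtx i x).
Proof. by rewrite /vtx sfun_act. Qed.

Record ssubset (X : sset) := SSubset {
  smem : forall n, X n -> Prop;
  smem_act : forall m n (a : dhom m n) (x : X n), smem x -> smem (sact a x) }.

Program Definition ssub (X : sset) (A : ssubset X) : sset :=
  @SSet (fun n => {x : X n | smem A x})
    (fun m n a x => exist _ (sact a (sval x)) (smem_act a (svalP x))) _ _.
Next Obligation. by move=> X A n [x p]; apply: eq_exist; rewrite sact_id. Qed.
Next Obligation. by move=> X A l m n a b [x p]; apply: eq_exist; rewrite sact_comp. Qed.

Coercion ssub : ssubset >-> sset.

Program Definition sincl (X : sset) (A : ssubset X) : smap A X :=
  @SMap A X (fun n x => sval x) _.

Program Definition scorestr (X Y : sset) (B : ssubset Y) (f : smap X Y)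
    (fB : forall n (x : X n), smem B (f n x)) : smap X B :=
  @SMap X B (fun n x => exist _ (f n x) (fB n x)) _.
Next Obligation. by move=> X Y B f fB m n a x; apply: eq_exist; rewrite sfun_act. Qed.

(* the 0-full simplicial subset on the vertices satisfying [P] *)
Program Definition full (X : sset) (P : X 0 -> Prop) : ssubset X :=
  @SSubset X (fun n x => forall i : 'I_n.+1, P (vtx i x)) _.
Next Obligation. by move=> X P m n a x xP i; rewrite vtx_act. Qed.

Program Definition Delta (n : nat) : sset :=
  @SSet (fun m => dhom m n) (fun l m a b => (b \o a : dhom l n)) _ _.
Next Obligation. by move=> n m b; apply: dhom_eq. Qed.
Next Obligation. by move=> n k l m a b c; apply: dhom_eq. Qed.

Program Definition Delta_map m n (a : dhom m n) : smap (Delta m) (Delta n) :=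
  @SMap (Delta m) (Delta n) (fun l b => (a \o b : dhom l n)) _.
Next Obligation. by move=> m n a k l b c; apply: dhom_eq. Qed.

Program Definition boundary n : ssubset (Delta n) :=
  @SSubset (Delta n) (fun m b => exists j : 'I_n.+1, forall i, b i <> j) _.
Next Obligation. by move=> n l m a b [j bj]; exists j => i; apply: bj. Qed.

Program Definition horn n (k : 'I_n.+1) : ssubset (Delta n) :=
  @SSubset (Delta n)
    (fun m b => exists2 j : 'I_n.+1, j <> k & forall i, b i <> j) _.
Next Obligation. by move=> n k l m a b [j jk bj]; exists j => // i; apply: bj. Qed.

Definition quasicategory (C : sset) : Prop :=
  forall n (k : 'I_n.+1), 0 < k < n -> forall f : smap (horn k) C,
  exists g : smap (Delta n) C, scomp g (sincl (horn k)) = f.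

Program Definition sprod (X Y : sset) : sset :=
  @SSet (fun n => (X n * Y n)%type)
    (fun m n a x => (sact a x.1, sact a x.2)) _ _.
Next Obligation. by move=> X Y n [x y]; rewrite !sact_id. Qed.
Next Obligation. by move=> X Y l m n a b [x y]; rewrite !sact_comp. Qed.

Declare Scope sset_scope.
Delimit Scope sset_scope with sset.
Bind Scope sset_scope with sset.
Notation "X * Y" := (sprod X Y) : sset_scope.

Program Definition sfst X Y : smap (X * Y)%sset X := @SMap (sprod X Y) X (fun _ z => z.1) _.

Program Definition ssnd X Y : smap (X * Y)%sset Y := @SMap (sprod X Y) Y (fun _ z => z.2) _.

Program Definition spair X Y Z (f : smap Z X) (g : smap Z Y) : smap Z (X * Y)%sset :=
  @SMap Z (sprod X Y) (fun n z => (f n z, g n z)) _.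
Next Obligation. by move=> X Y Z f g m n a z; rewrite !sfun_act. Qed.

Definition smul X X' Y Y' (f : smap X X') (g : smap Y Y') :
    smap (X * Y)%sset (X' * Y')%sset :=
  spair (scomp f (sfst X Y)) (scomp g (ssnd X Y)).

(* [sexp C A] is C^A *)
Program Definition sexp (C A : sset) : sset :=
  @SSet (fun n => smap (A * Delta n)%sset C)
    (fun m n a f => scomp f (smul (sid A) (Delta_map a))) _ _.
Next Obligation.
move=> C A n f; apply: smap_eq => m [x b] /=; congr (f _ (_, _)).
exact: dhom_eq.
Qed.
Next Obligation.
move=> C A l m n a b f; apply: smap_eq => k [x c] /=; congr (f _ (_, _)).
exact: dhom_eq.
Qed.

(* C^phi : C^B -> C^A *)
Program Definition sexp_pre C A B (phi : smap A B) : smap (sexp C B) (sexp C A) :=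
  @SMap (sexp C B) (sexp C A)
    (fun n f => scomp f (smul phi (sid (Delta n)))) _.
Next Obligation. by move=> C A B phi m n a f; apply: smap_eq. Qed.

(* F^K : C^K -> D^K *)
Program Definition sexp_post C D K (F : smap C D) : smap (sexp C K) (sexp D K) :=
  @SMap (sexp C K) (sexp D K) (fun n f => scomp F f) _.
Next Obligation. by move=> C D K F m n a f; apply: smap_eq. Qed.

(* the identification of maps K -> C with vertices of C^K, in both directions *)
Definition to_vertex C K (f : smap K C) : sexp C K 0 := scomp f (sfst K (Delta 0)).

Program Definition to_point K n : smap K (Delta n) := @SMap K (Delta n) (fun m _ => dconst m ord0) _.
Next Obligation. by move=> K n l m a x; apply: dhom_eq. Qed.

Definition of_vertex C K (f : sexp C K 0) : smap K C :=
  scomp f (spair (sid K) (to_point K 0)).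

Lemma to_vertexK C K : cancel (@to_vertex C K) (@of_vertex C K).
Proof. by move=> f; apply: smap_eq. Qed.

Lemma of_vertexK C K : cancel (@of_vertex C K) (@to_vertex C K).
Proof.
move=> f; apply: smap_eq => n [x b] /=; congr (f _ (_, _)).
by apply: dhom_eq => i; rewrite [b i]ord1.
Qed.

(* the value of an n-simplex of C^A at an n-simplex of A *)
Definition sev (C A : sset) n (f : sexp C A n) (x : A n) : C n := f n (x, idfun : dhom n n).

Program Definition sev_at (C A : sset) (x : A 0) : smap (sexp C A) C :=
  @SMap (sexp C A) C (fun n f => sev f (sact (dconst n ord0) x)) _.
Next Obligation.
move=> C A x m n a f; rewrite /sev /= -sfun_act /= -sact_comp.
by congr (f _ (sact _ _, _)); apply: dhom_eq.
Qed.

(* the exponential law (C^A)^B = (C^B)^A, exchanging the two variables *)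
Program Definition sswap C A B : smap (sexp (sexp C A) B) (sexp (sexp C B) A) :=
  @SMap (sexp (sexp C A) B) (sexp (sexp C B) A)
    (fun n f => @SMap (A * Delta n)%sset (sexp C B)
      (fun m xa => @SMap (B * Delta m)%sset C
        (fun l yb => sev (f l (yb.1, (xa.2 \o yb.2 : dhom l n))) (sact yb.2 xa.1)) _) _) _.
Next Obligation.
move=> C A B n f m [x a] k l c [y b]; rewrite /sev /=.
have e : (sact c y, (a \o (b \o c) : dhom k n)) =
    sact c ((y, (a \o b : dhom l n)) : (B * Delta n)%sset l).
  by congr pair; apply: dhom_eq.
rewrite {}e -sfun_act sfun_act /= sact_comp; congr (sfun _ _).
by congr pair; apply: dhom_eq.
Qed.
Next Obligation.
move=> C A B n f l m c [x a]; apply: smap_eq => k [y b] /=.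
rewrite sact_comp; congr (sev (f _ (_, _)) _); exact: dhom_eq.
Qed.
Next Obligation.
move=> C A B m n c f; apply: smap_eq => l [x a]; apply: smap_eq => k [y b] /=.
congr (sev (f _ (_, _)) _); exact: dhom_eq.
Qed.

Lemma sswapK C A B n (f : sexp (sexp C A) B n) :
  sswap C B A n (sswap C A B n f) = f.
Proof.
apply: smap_eq => m [y a]; apply: smap_eq => l [x b]; rewrite /sev /= sact_id.
have -> : (sact b y, ((a \o b) \o idfun : dhom l n)) =
    sact b ((y, a) : (B * Delta n)%sset m) by congr pair; apply: dhom_eq.
by rewrite sfun_act /=; congr (f _ _ _ _); congr pair; apply: dhom_eq.
Qed.

Definition fibre n (c : dhom n 1) (e : 'I_2) : ssubset (Delta n) :=
  @full (Delta n) (fun v : dhom 0 n => c (v ord0) = e).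

Program Definition fibre_vertex n (c : dhom n 1) (e : 'I_2) (i : 'I_n.+1)
    (ci : c i = e) : fibre c e 0 :=
  exist _ (dconst 0 i) _.
Next Obligation. by []. Qed.

Program Definition fibre_map m n (a : dhom m n) (c : dhom n 1) (e : 'I_2) :
    smap (fibre (c \o a : dhom m 1) e) (fibre c e) :=
  @scorestr _ _ (fibre c e) (scomp (Delta_map a) (sincl (fibre (c \o a : dhom m 1) e))) _.
Next Obligation. by move=> m n a c e l [b bP] i /=; exact: bP. Qed.

(* An n-simplex of X * Y is a cut of [n] into an initial and a final segment,
   a simplex of X on the initial segment and a simplex of Y on the final one.
   The cut is a map [c : [n] -> [1]]; its two fibres are each empty or a standard
   simplex, so that "a simplex of X on the initial segment" is a map from the
   fibre over 0 to X (no data if this segment is empty). *)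
Record join_simplex (X Y : sset) (n : nat) := JoinSimplex {
  jcut : dhom n 1;
  jleft : smap (fibre jcut ord0) X;
  jright : smap (fibre jcut ord_max) Y }.

Lemma join_simplex_eq X Y n (s t : join_simplex X Y n) :
    jcut s =1 jcut t ->
    (forall m x y, sval x = sval y -> jleft s m x = jleft t m y) ->
    (forall m x y, sval x = sval y -> jright s m x = jright t m y) ->
  s = t.
Proof.
case: s t => c l r [c' l' r'] /= /dhom_eq e; case: _ / e in l' r' *.
move=> el er; congr JoinSimplex; apply: smap_eq => m x; first exact: el.
exact: er.
Qed.

Lemma smap_congr (X : sset) (A : ssubset X) Y (f : smap A Y) n (x y : A n) :
  sval x = sval y -> f n x = f n y.
Proof. by case: x y => [x p] [y q] /= e; congr (f _ _); apply: eq_exist. Qed.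

Program Definition join (X Y : sset) : sset :=
  @SSet (join_simplex X Y)
    (fun m n a s => @JoinSimplex X Y m (jcut s \o a : dhom m 1)
       (scomp (jleft s) (fibre_map a (jcut s) ord0))
       (scomp (jright s) (fibre_map a (jcut s) ord_max))) _ _.
Next Obligation.
move=> X Y n s; apply: join_simplex_eq => //= m x y e; apply: smap_congr;
  by rewrite /= -e; apply: dhom_eq.
Qed.
Next Obligation.
move=> X Y l m n a b s; apply: join_simplex_eq => //= k x y e; apply: smap_congr;
  by rewrite /= -e; apply: dhom_eq.
Qed.

Fact fibre_const n m : fibre (dconst n ord0) ord_max m -> False.
Proof. by case=> b /(_ ord0) /(congr1 val). Qed.

(* X -> X * Y *)
Program Definition join_inl (X Y : sset) : smap X (join X Y) :=
  @SMap X (join X Y) (fun n x => @JoinSimplex X Y n (dconst n ord0)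
    (@SMap (fibre (dconst n ord0) ord0) X (fun m b => sact (sval b) x) _)
    (@SMap (fibre (dconst n ord0) ord_max) Y
       (fun m b => False_rect _ (fibre_const b)) _)) _.
Next Obligation. by move=> X Y n x l m a [b bP] /=; rewrite sact_comp. Qed.
Next Obligation. by move=> X Y n x l m a b; have := fibre_const b. Qed.
Next Obligation.
move=> X Y m n a x; apply: join_simplex_eq => //= l [y yP] [z zP] /= e.
  by rewrite -sact_comp -e; congr (sact _ _); apply: dhom_eq.
by have := yP ord0.
Qed.

Program Definition join_map X Y Y' (f : smap Y Y') : smap (join X Y) (join X Y') :=
  @SMap (join X Y) (join X Y')
    (fun n s => @JoinSimplex X Y' n (jcut s) (jleft s) (scomp f (jright s))) _.
Next Obligation. by move=> X Y Y' f m n a s; congr JoinSimplex; apply: smap_eq. Qed.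

Lemma join_map_inl X Y Y' (f : smap Y Y') :
  scomp (join_map X f) (join_inl X Y) = join_inl X Y'.
Proof.
apply: smap_eq => n x; apply: join_simplex_eq => //= m [y yP] [z zP] /= e.
  by rewrite e.
by have := yP ord0.
Qed.

Lemma join_map_id X Y (f : smap Y Y) n (s : join X Y n) :
  f = sid Y -> join_map X f n s = s.
Proof. by move=> ->; case: s => c l r; congr JoinSimplex; apply: smap_eq. Qed.

Lemma join_map_comp X Y Y' Y'' (g : smap Y' Y'') (f : smap Y Y') h n (s : join X Y n) :
  h = scomp g f -> join_map X h n s = join_map X g n (join_map X f n s).
Proof. by move=> ->; case: s => c l r; congr JoinSimplex; apply: smap_eq. Qed.

(* [d\C]: its n-simplices are the maps A * Delta[n] -> C restricting to [d] on A *)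
Program Definition under (A C : sset) (d : smap A C) : sset :=
  @SSet (fun n => {g : smap (join A (Delta n)) C | scomp g (join_inl A (Delta n)) = d})
    (fun m n a g => exist _ (scomp (sval g) (join_map A (Delta_map a))) _) _ _.
Next Obligation.
move=> A C d m n a [g gd] /=; rewrite -[RHS]gd -(join_map_inl A (Delta_map a)).
exact: smap_eq.
Qed.
Next Obligation.
move=> A C d n [g gd]; apply: eq_exist; apply: smap_eq => m s /=; congr (g _ _).
by apply: join_map_id; apply: smap_eq => l b; apply: dhom_eq.
Qed.
Next Obligation.
move=> A C d l m n a b [g gd]; apply: eq_exist; apply: smap_eq => k s /=; congr (g _ _).
by apply: join_map_comp; apply: smap_eq => p c; apply: dhom_eq.
Qed.

Program Definition boundary_vertex n : boundary n.+1 0 :=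
  exist _ (dconst 0 ord0) _.
Next Obligation. by move=> n; exists ord_max => i /(congr1 val). Qed.

(* every sphere with initial vertex [v] can be filled *)
Definition initial (X : sset) (v : X 0) : Prop :=
  forall n (f : smap (boundary n.+1) X), f 0 (boundary_vertex n) = v ->
  exists g : smap (Delta n.+1) X, scomp g (sincl (boundary n.+1)) = f.

(* The first coordinate is the horizontal one *)
Definition shapeJ : sset := (Delta 1 * Delta 1)%sset.

Definition corner (a b : 'I_2) : shapeJ 0 := (dconst 0 a, dconst 0 b).

Definition left_edgeJ : shapeJ 1 := (dconst 1 ord0, idfun : dhom 1 1).

(* The subcategory determined by the top and the left maps is the full one on the
   three objects other than the bottom right corner, so its nerve is 0-full in J *)
Definition shapeI : ssubset shapeJ := full (fun v => v <> corner ord_max ord_max).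

Lemma corner_neq (v : shapeJ 0) : v.1 ord0 = ord0 \/ v.2 ord0 = ord0 ->
  v <> corner ord_max ord_max.
Proof. by move=> h e; move: h; rewrite e /= => -[] /(congr1 val). Qed.

Program Definition left_edge : shapeI 1 := exist _ left_edgeJ _.
Next Obligation. by move=> i; apply: corner_neq; left. Qed.

Program Definition top_left : shapeI 0 := exist _ (corner ord0 ord0) _.
Next Obligation. by move=> i; apply: corner_neq; left. Qed.

Program Definition top_right : shapeI 0 := exist _ (corner ord_max ord0) _.
Next Obligation. by move=> i; apply: corner_neq; right. Qed.

Program Definition bottom_left : shapeI 0 := exist _ (corner ord0 ord_max) _.
Next Obligation. by move=> i; apply: corner_neq; left. Qed.


(* the map X * Y -> Delta[1] equal to [p] on X and constant at 1 on Y *)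
Section ConeMap.
Variables (X Y : sset) (p : smap X (Delta 1)).

Definition cone_fun n (s : join X Y n) (i : 'I_n.+1) : 'I_2 :=
  match jcut s i =P ord0 with
  | ReflectT h => p 0 (jleft s 0 (fibre_vertex h)) ord0
  | ReflectF _ => ord_max
  end.

Lemma cone_funE n (s : join X Y n) m (x : fibre (jcut s) ord0 m) (i : 'I_m.+1) :
  cone_fun s (sval x i) = p m (jleft s m x) i.
Proof.
rewrite /cone_fun; case: eqP => [h|[]]; last exact: (svalP x i).
have -> : p m (jleft s m x) i = vtx i (p m (jleft s m x)) ord0 by [].
rewrite !vtx_map; congr (p _ _ _); apply: smap_congr => /=.
exact: dhom_eq.
Qed.

Lemma cone_funT n (s : join X Y n) (i : 'I_n.+1) :
  jcut s i = ord_max -> cone_fun s i = ord_max.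
Proof. by rewrite /cone_fun; case: eqP => // h e; have := congr1 val h; rewrite e. Qed.

Fact cone_fun_leq n (s : join X Y n) (i j : 'I_n.+1) :
  i <= j -> cone_fun s i <= cone_fun s j.
Proof.
move=> ij; case: (jcut s j =P ord0) => [jC|jC]; last first.
  rewrite (@cone_funT _ s j) ?leq_ord //.
  apply: val_inj => /=; case: (jcut s j) jC => -[|[]] // h []; exact: val_inj.
have iC : jcut s i = ord0.
  by apply: val_inj; have := dhom_leq (jcut s) ij; rewrite jC leqn0 => /eqP.
have bP (k l : 'I_2) : k <= l ->
    (if k == ord0 then i else j) <= (if l == ord0 then i else j).
  by case: k l => -[|[]] // ? [[|[]]].
pose x : fibre (jcut s) ord0 1 :=
  @exist _ (@smem _ (fibre (jcut s) ord0) 1) (mk_dhom bP) (fun k : 'I_2 =>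
    (if k == ord0 as b return jcut s (if b then i else j) = ord0 then iC else jC)).
by rewrite (cone_funE x ord0) (cone_funE x ord_max) dhom_leq.
Qed.

Fact cone_fun_act m n (a : dhom m n) (s : join X Y n) (i : 'I_m.+1) :
  cone_fun (sact a s) i = cone_fun s (a i).
Proof.
case: (jcut s (a i) =P ord0) => h.
  have e : jcut (sact a s) i = ord0 by [].
  rewrite -[RHS]/(cone_fun s (sval (fibre_vertex h) ord0)) cone_funE.
  rewrite -[LHS]/(cone_fun (sact a s) (sval (fibre_vertex e) ord0)) cone_funE.
  congr (p _ _ _); apply: (smap_congr (jleft s)); exact: dhom_eq.
have {}h : jcut s (a i) = ord_max.
  by apply: val_inj; case: (jcut s (a i)) h => -[|[]] // ? []; apply: val_inj.
by rewrite !cone_funT.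
Qed.

Program Definition cone_map : smap (join X Y) (Delta 1) :=
  @SMap (join X Y) (Delta 1) (fun n s => mk_dhom (@cone_fun_leq n s)) _.
Next Obligation. by move=> m n a s; apply: dhom_eq => i; apply: cone_fun_act. Qed.

Lemma cone_map_inl : scomp cone_map (join_inl X Y) = p.
Proof.
apply: smap_eq => n x; apply: dhom_eq => i.
pose y : fibre (dconst n ord0) ord0 n := 
  @exist _ (@smem _ (fibre (dconst n ord0) ord0) n) idfun (fun=> erefl).
by rewrite -[LHS]/(cone_fun (join_inl X Y n x) (sval y i)) cone_funE /= sact_id.
Qed.

End ConeMap.

(* the isomorphism I * Delta[0] -> J extending the inclusion of I *)
Definition shapeIJ : smap shapeI shapeJ := sincl shapeI.

Definition cone_to_shapeJ : smap (join shapeI (Delta 0)) shapeJ :=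
  spair (cone_map (Delta 0) (scomp (sfst _ _) shapeIJ))
        (cone_map (Delta 0) (scomp (ssnd _ _) shapeIJ)).

Lemma cone_to_shapeJ_inl :
  scomp cone_to_shapeJ (join_inl shapeI (Delta 0)) = shapeIJ.
Proof.
apply: smap_eq => n x.
have := congr1 (fun f : smap _ _ => f n x)
  (cone_map_inl (Delta 0) (scomp (sfst _ _) shapeIJ)).
have := congr1 (fun f : smap _ _ => f n x)
  (cone_map_inl (Delta 0) (scomp (ssnd _ _) shapeIJ)).
by move=> /= e1 e2; rewrite e1 e2 -surjective_pairing.
Qed.

(* the vertex of [d\C], with [d] the restriction of [S] to I, given by [S] *)
Program Definition square_cocone C (S : smap shapeJ C) : under (scomp S shapeIJ) 0 :=
  exist _ (scomp S cone_to_shapeJ) _.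
Next Obligation. by move=> C S; rewrite -[in RHS]cone_to_shapeJ_inl; apply: smap_eq. Qed.

(* a pushout square: a colimit cocone, i.e. an initial vertex of [d\C] *)
Definition pushout_square C (S : smap shapeJ C) : Prop := initial (square_cocone S).

(* C^I_co *)
Definition spans_co (C : sset) (cof : C 1 -> Prop) : ssubset (sexp C shapeI) :=
  full (fun d : sexp C shapeI 0 => cof (of_vertex d 1 left_edge)).

(* C^J_(co,po) *)
Definition squares_co_po (C : sset) (cof : C 1 -> Prop) : ssubset (sexp C shapeJ) :=
  full (fun q : sexp C shapeJ 0 =>
    cof (of_vertex q 1 left_edgeJ) /\ pushout_square (of_vertex q)).

Definition admits_pushouts (C : sset) (cof : C 1 -> Prop) : Prop :=
  forall D : smap shapeI C, cof (D 1 left_edge) ->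
  exists S : smap shapeJ C, scomp S shapeIJ = D /\ pushout_square S.

Program Definition restrict_co (C : sset) (cof : C 1 -> Prop) :
    smap (squares_co_po cof) (spans_co cof) :=
  @scorestr _ _ (spans_co cof) (scomp (sexp_pre C shapeIJ) (sincl (squares_co_po cof))) _.
Next Obligation. by move=> C cof n [q qP] i; case: (qP i). Qed.

Definition functorial_pushouts (C : sset) (cof : C 1 -> Prop)
    (F : smap (spans_co cof) (squares_co_po cof)) : Prop :=
  scomp (restrict_co cof) F = sid (spans_co cof).

Definition objwise (C : sset) (cof : C 1 -> Prop) (K : sset) (e : sexp C K 1) : Prop :=
  forall k : K 0, cof (sev_at C k 1 e).

(* the identification of (C^K)^I_co with (C^I_co)^K *)
Program Definition spans_co_exp (C : sset) (cof : C 1 -> Prop) (K : sset) :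
    smap (spans_co (objwise cof (K := K))) (sexp (spans_co cof) K) :=
  @SMap (spans_co (objwise cof (K := K))) (sexp (spans_co cof) K)
    (fun n f => @scorestr _ _ (spans_co cof) (sswap C K shapeI n (sval f)) _) _.
Next Obligation.
move=> C cof K n [f fP] m [k a] i.
have := fP (a i) (vtx i k); rewrite /sev_at /= /vtx.
set u := (X in cof X -> _); set v := (X in _ -> cof X); suff -> : v = u by [].
have e (b b' : dhom 1 n) (x x' : K 1) : b = b' -> x = x' ->
    sev (f 1 (left_edge, b)) x = sev (f 1 (left_edge, b')) x' by move=> -> ->.
apply: e; [exact: dhom_eq | rewrite -sact_comp; congr (sact _ k); exact: dhom_eq].
Qed.
Next Obligation.
move=> C cof K m n a [f fP]; apply: smap_eq => l [k b] /=; apply: eq_exist.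
apply: smap_eq => p [x c] /=.
have -> // : ((a \o b) \o c : dhom p n) = (a \o (b \o c) : dhom p n).
exact: dhom_eq.
Qed.

(* (F_po)^K, under the identification above on the source and the exchange of
   variables (C^J)^K = (C^K)^J on the target *)
Definition objwise_pushouts (C : sset) (cof : C 1 -> Prop)
    (F : smap (spans_co cof) (squares_co_po cof)) (K : sset) :
    smap (spans_co (objwise cof (K := K))) (sexp (sexp C K) shapeJ) :=
  scomp (sswap C shapeJ K)
    (scomp (sexp_post K (sincl (squares_co_po cof)))
      (scomp (sexp_post K F) (spans_co_exp cof K))).

Program Definition span_co_vertex (C : sset) (cof : C 1 -> Prop)
    (D : smap shapeI C) (hD : cof (D 1 left_edge)) : spans_co cof 0 :=
  exist _ (to_vertex D) _.
Next Obligation. by []. Qed.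

(* the selected pushout square of a span in C^K whose left leg is an object-wise
   cofibration, and the object of C^K at its bottom right corner *)
Definition pushout_sq (C : sset) (cof : C 1 -> Prop)
    (F : smap (spans_co cof) (squares_co_po cof)) (K : sset)
    (D : smap shapeI (sexp C K)) (hD : objwise cof (D 1 left_edge)) :
    smap shapeJ (sexp C K) :=
  of_vertex (objwise_pushouts F K 0 (span_co_vertex hD)).

Definition pushout_obj (C : sset) (cof : C 1 -> Prop)
    (F : smap (spans_co cof) (squares_co_po cof)) (K : sset)
    (D : smap shapeI (sexp C K)) (hD : objwise cof (D 1 left_edge)) : smap K C :=
  of_vertex (pushout_sq F hD 0 (corner ord_max ord_max)).

(* [P] is the selected pushout of V <- T -> U: the span [D] has the objects T, U, V,
   its leg T -> V is an object-wise cofibration, and [P] is the object selected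
   for it *)
Record is_pushout_of (C : sset) (cof : C 1 -> Prop)
    (F : smap (spans_co cof) (squares_co_po cof)) (K : sset)
    (D : smap shapeI (sexp C K)) (T U V P : smap K C) : Prop := IsPushoutOf {
  pushout_T : of_vertex (D 0 top_left) = T;
  pushout_U : of_vertex (D 0 top_right) = U;
  pushout_V : of_vertex (D 0 bottom_left) = V;
  pushout_co : objwise cof (D 1 left_edge);
  pushout_P : P = pushout_obj F pushout_co }.

Definition dshape n : sset := (Delta 2 * Delta n * Delta n)%sset.

Definition dshape_map m n (a : dhom m n) : smap (dshape m) (dshape n) :=
  smul (smul (sid (Delta 2)) (Delta_map a)) (Delta_map a).

(* Main.v *)
Require Import Defs.
From mathcomp Require Import all_boot all_order.
From mathcomp Require Import boolp.

(** Pushouts along object-wise cofibrations are computed by applying the single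
    map [F] after a diagram [y : K -> C^I_co] of spans: the selected squares are
    [F o y].  A map [phi : K' -> K] acts on diagrams by precomposition, and
    [F o (y o phi) = (F o y) o phi], so that the selected pushouts commute
    strictly with restriction along any [phi].  Faces and degeneracies are the
    instances where [phi] is [Id x a x a].

    What has to be checked is that the identification of (C^K)^I_co with
    (C^I_co)^K, through which [F] is applied, is natural in [K]
    ([spans_co_exp_pre]), and that object-wise cofibrations are stable under
    restriction ([objwise_pre]).  Together they give [is_pushout_of_pre], the statement
    for an arbitrary [phi]. *)

Set Implicit Arguments.
Unset Strict Implicit.
Unset Printing Implicit Defensive.

Section Restriction.
Variables (C : sset) (cof : C 1 -> Prop) (K' K : sset) (phi : smap K' K).

(** The component of the restricted morphism at a vertex [k] of [K'] is the
    component of the original one at [phi k]. *)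
Lemma objwise_pre (e : sexp C K 1) :
  objwise cof e -> objwise cof (sexp_pre C phi 1 e).
Proof. by move=> eco k; have := eco (phi 0 k); rewrite /sev_at /sev /= sfun_act. Qed.

Lemma of_vertex_pre (f : sexp C K 0) :
  of_vertex (sexp_pre C phi 0 f) = scomp (of_vertex f) phi.
Proof. exact: smap_eq. Qed.

Variable D : smap shapeI (sexp C K).
Hypothesis D_co : objwise cof (D 1 left_edge).
Hypothesis D'_co : objwise cof (scomp (sexp_pre C phi) D 1 left_edge).

(** Naturality in [K] of the identification of (C^K)^I_co with (C^I_co)^K: both
    sides evaluate [D] at a simplex of I and at the image in [K] of a simplex of
    [K'], and differ only in whether the simplicial operator is applied before or
    after [phi]. *)
Lemma spans_co_exp_pre :
  spans_co_exp cof K' 0 (span_co_vertex D'_co) =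
  sexp_pre (spans_co cof) phi 0 (spans_co_exp cof K 0 (span_co_vertex D_co)).
Proof.
apply: smap_eq => m [k a]; apply: eq_exist; apply: smap_eq => l [x c].
by rewrite /sev /= sfun_act.
Qed.

Variable F : smap (spans_co cof) (squares_co_po cof).

(** Applying [F] is a postcomposition, hence commutes with the precomposition
    with [phi]. *)
Lemma pushout_obj_pre : pushout_obj F D'_co = scomp (pushout_obj F D_co) phi.
Proof.
apply: smap_eq => m k; congr (sev (sval (F m _)) _).
exact: (congr1 (fun y : sexp _ K' 0 => y m (k, _)) spans_co_exp_pre).
Qed.

End Restriction.

(** Faces and degeneracies enter only as maps between shapes, so that one
    statement about an arbitrary [phi] covers both. *)
Lemma is_pushout_of_pre (C : sset) (cof : C 1 -> Prop) (K' K : sset)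
    (phi : smap K' K) (F : smap (spans_co cof) (squares_co_po cof))
    (D : smap shapeI (sexp C K)) (T U V P : smap K C) :
  is_pushout_of F D T U V P ->
  is_pushout_of F (scomp (sexp_pre C phi) D)
    (scomp T phi) (scomp U phi) (scomp V phi) (scomp P phi).
Proof.
case=> <- <- <- D_co ->.
have D'_co : objwise cof (scomp (sexp_pre C phi) D 1 left_edge).
  exact: objwise_pre.
exists D'_co; [exact: of_vertex_pre.. | by rewrite -pushout_obj_pre].
Qed.

Theorem corollary3p36 (C : sset) (cof : C 1 -> Prop)
    (C_quasicategory : quasicategory C)
    (cof_id : forall x : C 0, cof (idedge x))
    (C_pushouts : admits_pushouts cof)
    (F : smap (spans_co cof) (squares_co_po cof))
    (F_choice : functorial_pushouts F)
    (n : nat) (T U V : smap (dshape n) C)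
    (D : smap shapeI (sexp C (dshape n)))
    (D_T : of_vertex (D 0 top_left) = T)
    (D_U : of_vertex (D 0 top_right) = U)
    (D_V : of_vertex (D 0 bottom_left) = V)
    (D_co : objwise cof (D 1 left_edge)) :
  let P := pushout_obj F D_co in
  (forall (n_gt0 : 0 < n) (i : 'I_n.+1),
     let d := dshape_map (coface n_gt0 i) in
     is_pushout_of F (scomp (sexp_pre C d) D)
       (scomp T d) (scomp U d) (scomp V d) (scomp P d)) /\
  (forall i : 'I_n.+1,
     let s := dshape_map (codegen i) in
     is_pushout_of F (scomp (sexp_pre C s) D)
       (scomp T s) (scomp U s) (scomp V s) (scomp P s)).
Proof.
move=> P.
have PD : is_pushout_of F D T U V P by exists D_co.
by split=> [n_gt0 i | i] /=; apply: is_pushout_of_pre.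
Qed.
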